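(* Let $n\ge 3$. If an antipodal $2$-edge-colouring of the hypercube $Q_n$ has no unresolved square faces, then there exists a monochromatic path in $Q_n$ joining some vertex $v$ to its antipode $\tau(v)$.
   Context: $Q_n$ is the graph on $\{0,1\}^n$ in which two vertices are adjacent if they differ in exactly one coordinate, and $\tau(u_1,\dots,u_n)=(1-u_1,\dots,1-u_n)$ is the antipodal involution. A $2$-edge-colouring of $Q_n$ is a function $E(Q_n)\to\{\text{red},\text{blue}\}$; it is antipodal if the edges $uv$ and $\tau(u)\tau(v)$ have different colours for every edge $uv$. A path is monochromatic if all its edges have the same colour. A square face of $Q_n$ is a $4$-cycle of $Q_n$ (obtained by letting two coordinates vary and fixing the others). Given a colouring, a square face is resolved if some pair of opposite vertices of the square is connected by a monochromatic path in the whole graph $Q_n$ (the path need not stay in the square); otherwise it is unresolved. *)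

(* Defs.v *)
From HB Require Import structures.
From mathcomp Require Import all_boot.

Set Implicit Arguments.
Unset Strict Implicit.
Unset Printing Implicit Defensive.

Variant colour := Red | Blue.

Definition is_red (k : colour) : bool := if k is Red then true else false.
Definition colour_of_bool (b : bool) : colour := if b then Red else Blue.

Lemma is_redK : cancel is_red colour_of_bool.
Proof. by case. Qed.

HB.instance Definition _ := Equality.copy colour (can_type is_redK).

Notation vertex n := {ffun 'I_n -> bool}.

Definition adj (n : nat) : rel (vertex n) :=
  fun u v => #|[set i | u i != v i]| == 1.

Definition antipode (n : nat) (u : vertex n) : vertex n := [ffun i => ~~ u i].

Definition is_edge (n : nat) (e : {set vertex n}) : bool :=
  [exists u, exists v, adj u v && (e == [set u; v])].

Notation edge n := {e : {set vertex n} | is_edge e}.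

Lemma adj_is_edge (n : nat) (u v : vertex n) : adj u v -> is_edge [set u; v].
Proof.
by move=> uv; apply/existsP; exists u; apply/existsP; exists v; rewrite uv /=.
Qed.

Definition mk_edge (n : nat) (u v : vertex n) (uv : adj u v) : edge n :=
  exist _ [set u; v] (adj_is_edge uv).

Lemma adj_antipode (n : nat) (u v : vertex n) :
  adj u v -> adj (antipode u) (antipode v).
Proof.
rewrite /adj => /eqP <-; apply/eqP; congr #|pred_of_set _|.
by apply/setP => i; rewrite !inE !ffunE (inj_eq negb_inj).
Qed.

Definition colouring (n : nat) : Type := edge n -> colour.

Definition antipodal (n : nat) (c : colouring n) : Prop :=
  forall (u v : vertex n) (uv : adj u v),
    c (mk_edge uv) <> c (mk_edge (adj_antipode uv)).

(* [adj_col c k u v]: [u] and [v] are joined by an edge of colour [k]. *)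
Definition adj_col (n : nat) (c : colouring n) (k : colour) : rel (vertex n) :=
  fun u v => [exists e : edge n, (val e == [set u; v]) && (c e == k)].

(* The path has vertex sequence [u :: p]; its vertices are distinct. *)
Definition mono_connected (n : nat) (c : colouring n) (u v : vertex n) : Prop :=
  exists (k : colour) (p : seq (vertex n)),
    [/\ path (adj_col c k) u p, uniq (u :: p) & last u p = v].

Definition square_face (n : nat) (S : {set vertex n}) : Prop :=
  exists (i j : 'I_n) (w : vertex n),
    i != j /\ S = [set u : vertex n | [forall k, (k \notin [set i; j]) ==> (u k == w k)]].

(* Two vertices of a 4-cycle of the hypercube are opposite on it iff they are
   distinct and not adjacent. *)
Definition resolved (n : nat) (c : colouring n) (S : {set vertex n}) : Prop :=
  exists u v : vertex n,
    [/\ u \in S, v \in S, u != v, ~~ adj u v & mono_connected c u v].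

(* Main.v *)
Require Import Defs.
From mathcomp Require Import all_boot all_order all_algebra.
From mathcomp Require Import zify.

Set Implicit Arguments.
Unset Strict Implicit.
Unset Printing Implicit Defensive.

Import GRing.Theory.

(** Suppose that no monochromatic path joins a vertex to its antipode, and let
    [H] be the bipartite graph whose nodes are the red and the blue components
    of the cube, each vertex [v] of the cube giving the edge of [H] between the
    red and the blue component of [v]; vertices with the same two components
    give the same edge. Walking along a red (blue) edge of the cube amounts to
    turning around a red (blue) node of [H], so the cube maps to [H]. A square
    which is not coloured alternately always has a contractible image, and a
    resolved alternating square has one too, as its vertices all lie in one
    component. The antipode exchanges the two kinds of nodes of [H]. It fixes no
    edge of [H] either, since an edge which is given by both [v] and its
    antipode puts the two in the same red component; thus it acts freely on [H].
    As the 2-skeleton of the cube is simply connected, lifting to the universal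
    cover of [H] would give a free involution of a tree, which is impossible.

    The proof below is the cohomological form of this argument.  Since the
    antipode fixes no edge of [H], there is a 0-1 labelling [g] of the edges of
    [H] which it complements.  Give the step [u -> v] of the cube the weight
    [g v - g u] if it is red and [g u - g v] if it is blue.  These weights are
    - closed on squares ([weight_square]), hence the differences of a potential
      [h] on the cube ([closed_exact]);
    - invariant under the antipode ([weight_antipode]), so that [h] takes the
      same value at [v] and at its antipode;
    - congruent to [g v - g u] modulo 2, so that [h] changes parity between [v]
      and its antipode, as [g] does.
    The last two properties contradict each other. *)

(** * Flips of coordinates *)

Section Flip.

Variable n : nat.
Implicit Types (u v : vertex n) (i j : 'I_n).

Definition flip i u : vertex n := [ffun k => (k == i) (+) u k].

Lemma flipK i : involutive (flip i).
Proof. by move=> u; apply/ffunP=> k; rewrite !ffunE addbA addbb. Qed.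

Lemma flipC i j u : flip i (flip j u) = flip j (flip i u).
Proof. by apply/ffunP=> k; rewrite !ffunE addbCA. Qed.

Lemma antipodeK : involutive (@antipode n).
Proof. by move=> u; apply/ffunP=> k; rewrite !ffunE negbK. Qed.

Lemma antipode_flip i u : antipode (flip i u) = flip i (antipode u).
Proof. by apply/ffunP=> k; rewrite !ffunE addbN. Qed.

Lemma adj_flip i u : adj u (flip i u).
Proof.
rewrite /adj -(cards1 i); apply/eqP; congr #|pred_of_set _|.
apply/setP=> k; rewrite !inE !ffunE.
by case: (k == i); case: (u k).
Qed.

Lemma flip_ind (P : vertex n -> Prop) u :
  P u -> (forall i v, P v -> P (flip i v)) -> forall v, P v.
Proof.
move=> Pu Pflip v.
have Pfold (s : seq 'I_n) : P (foldr flip u s).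
  by elim: s => //= i s; apply: Pflip.
have foldE (s : seq 'I_n) k : uniq s -> foldr flip u s k = (k \in s) (+) u k.
  elim: s => [|i s IHs] //= /andP[is_ /IHs]; rewrite ffunE inE => ->.
  by case: (eqVneq k i) is_ => [->|_] //= /negPf->.
suff -> : v = foldr flip u [seq i <- enum 'I_n | u i != v i] by apply: Pfold.
apply/ffunP=> k; rewrite foldE; last exact: filter_uniq (enum_uniq _).
by rewrite mem_filter mem_enum; case: (u k); case: (v k).
Qed.

(** Exactness of the cochain complex of the cube in degree 1.  The potential is
    built one direction [i] at a time: it is kept on the face where coordinate
    [i] vanishes, and transported along direction [i] to the opposite face;
    closedness on the squares in directions [i] and [j] says that the result is
    still a potential in direction [j]. *)
Lemma closed_exact (w : 'I_n -> vertex n -> int) :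
    (forall i u, w i (flip i u) = - w i u)%R ->
    (forall i j u, i != j ->
       w i u + w j (flip i u) = w j u + w i (flip j u))%R ->
  exists h : vertex n -> int, forall i u, (h (flip i u) = h u + w i u)%R.
Proof.
move=> w_anti w_sq.
suff partial (s : seq 'I_n) : exists h : vertex n -> int,
    {in s, forall i u, (h (flip i u) = h u + w i u)%R}.
  have [h hP] := partial (enum 'I_n).
  by exists h => i; apply: hP; rewrite mem_enum.
elim: s => [|i s [h hP]]; first by exists (fun=> 0%R).
exists (fun u => if u i then h (flip i u) + w i (flip i u) else h u)%R.
move=> j; rewrite inE => js u; rewrite ffunE.
case: (eqVneq i j) js => [<- _|ij /= js].
  by rewrite flipK w_anti /=; case: (u i) => /=; lia.
rewrite /=; case: (u i); last exact: hP.
have := w_sq i j (flip i u) ij.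
by rewrite (flipC i j) hP // flipK; lia.
Qed.

End Flip.

(** * Coloured edges and their components *)

Section Colouring.

Variables (n : nat) (c : colouring n).
Implicit Types (u v : vertex n) (i j : 'I_n) (k : colour).

Definition opp_colour k := if k is Red then Blue else Red.

Lemma adj_sym u v : adj u v = adj v u.
Proof.
by congr (_ == _); apply: eq_card => i; rewrite !inE eq_sym.
Qed.

Lemma adj_colE k u v (uv : adj u v) : adj_col c k u v = (c (mk_edge uv) == k).
Proof.
apply/existsP/idP=> [[e /andP[/eqP ve]]|cuv].
  by have -> : e = mk_edge uv by apply: val_inj.
by exists (mk_edge uv); rewrite eqxx.
Qed.

Lemma adj_col_adj k u v : adj_col c k u v -> adj u v.
Proof.
case/existsP=> -[e e_edge] /andP[/eqP /= euv _].
case/existsP: e_edge => x /existsP[y /andP[xy /eqP]]; rewrite euv => /setP E.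
move: xy (E u) (E v) (E x) (E y); rewrite !inE !eqxx ?orbT /=.
move=> xy /esym/orP[]/eqP eu /esym/orP[]/eqP ev /orP[]/eqP ex /orP[]/eqP ey;
  by [congruence | rewrite adj_sym; congruence].
Qed.

Lemma adj_col_sym k : symmetric (adj_col c k).
Proof. by move=> u v; rewrite /adj_col setUC. Qed.

Lemma connect_col_sym k : connect_sym (adj_col c k).
Proof. exact/sym_connect_sym/adj_col_sym. Qed.

Lemma adj_col_blue u v :
  adj u v -> adj_col c Blue u v = ~~ adj_col c Red u v.
Proof. by move=> uv; rewrite !(adj_colE _ uv); case: (c _). Qed.

Lemma connect_mono k u v : connect (adj_col c k) u v -> mono_connected c u v.
Proof.
case/connectP=> p pP ->; case/shortenP: pP => p' p'P Up' _.
by exists k, p'.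
Qed.

Lemma mono_connect u v :
  mono_connected c u v -> exists k, connect (adj_col c k) u v.
Proof. by case=> k [p [pP _ <-]]; exists k; apply/connectP; exists p. Qed.

(** The node of colour [k] of [H] at the vertex [u]: a representative of its
    component. *)
Definition component k u := fingraph.root (adj_col c k) u.

Lemma componentE k u v :
  (component k u == component k v) = connect (adj_col c k) u v.
Proof. exact: root_connect (connect_col_sym k) u v. Qed.

Lemma component_adj u v : adj u v ->
  component (if adj_col c Red u v then Red else Blue) u =
  component (if adj_col c Red u v then Red else Blue) v.
Proof.
move=> uv; apply/eqP; rewrite componentE; apply: connect1.
by case: ifPn => // ?; rewrite adj_col_blue.
Qed.

Section Antipodal.

Hypothesis anti : antipodal c.

Lemma adj_col_antipode k u v :
  adj_col c k u v -> adj_col c (opp_colour k) (antipode u) (antipode v).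
Proof.
move=> kuv; have uv := adj_col_adj kuv.
move: kuv; rewrite (adj_colE _ uv) (adj_colE _ (adj_antipode uv)).
by move: (@anti u v uv); case: (c _); case: (c _); case: k.
Qed.

Lemma component_antipode k u v :
    component k u = component k v ->
  component (opp_colour k) (antipode u) = component (opp_colour k) (antipode v).
Proof.
move/eqP; rewrite componentE => /connectP[p pP ->]; apply/eqP.
rewrite componentE; apply/connectP; exists (map (@antipode n) p).
  elim: p u pP => //= x p IHp u /andP[ux /IHp ->].
  by rewrite adj_col_antipode.
by rewrite last_map.
Qed.

End Antipodal.

(** Two vertices of the face are opposite exactly when they differ in both
    directions, so resolving the face joins one of its two diagonals. *)
Lemma resolved_diagonal i j u : i != j ->
    resolved c [set v : vertex n |
      [forall k, (k \notin [set i; j]) ==> (v k == u k)]] ->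
  exists k, component k u = component k (flip i (flip j u)) \/
            component k (flip i u) = component k (flip j u).
Proof.
move=> ij [x [y [xS yS xy nxy /mono_connect[k kxy]]]].
have {}kxy : component k x = component k y by apply/eqP; rewrite componentE.
have corners v : v \in [set v : vertex n |
      [forall k, (k \notin [set i; j]) ==> (v k == u k)]] ->
    v \in [:: u; flip i u; flip j u; flip i (flip j u)].
  rewrite inE => /forallP vS.
  have flipE l b (w : vertex n) m :
      (if b then flip l else id) w m = ((m == l) && b) (+) w m.
    by case: b; rewrite ?ffunE ?andbT ?andbF.
  have -> : v = (if v i (+) u i then flip i else id)
                  ((if v j (+) u j then flip j else id) u).
    apply/ffunP=> l; rewrite !flipE; have := vS l; rewrite !inE negb_or.
    case: (eqVneq l i) => [->|li]; first by rewrite (negPf ij) /= addbK.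
    case: (eqVneq l j) => [->|lj]; first by rewrite /= addbK.
    by move=> /eqP->.
  by rewrite !inE; do 2!case: (_ (+) _); rewrite eqxx ?orbT.
exists k.
have nadj l (a : vertex n) : adj (flip l a) a by rewrite adj_sym adj_flip.
move: xy nxy kxy; move: (corners x xS) (corners y yS); rewrite !inE.
case/or4P=> /eqP->; case/or4P=> /eqP->; rewrite ?eqxx ?adj_flip ?nadj //;
  rewrite 1?(flipC i j u) ?adj_flip ?nadj // => _ _ ->; by [left | right].
Qed.

End Colouring.

(** * The weights *)

Section Weight.

Variables (n : nat) (c : colouring n) (g : vertex n -> bool).
Implicit Types (u v : vertex n) (i j : 'I_n).

Definition weight i u : int :=
  ((-1) ^+ (~~ adj_col c Red u (flip i u)) * ((g (flip i u))%:Z - (g u)%:Z))%R.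

Lemma weight_flip i u : (weight i (flip i u) = - weight i u)%R.
Proof.
rewrite /weight flipK adj_col_sym.
by case: adj_col; rewrite /= ?expr0 ?expr1; lia.
Qed.

(** The antipode changes both the colour of a step and the sign of the
    difference of [g] along it. *)
Lemma weight_antipode i u :
    antipodal c -> (forall v, g (antipode v) = ~~ g v) ->
  weight i (antipode u) = weight i u.
Proof.
move=> anti g_anti.
have -> : weight i (antipode u) = ((-1) ^+ (adj_col c Red u (flip i u)) *
    ((g u)%:Z - (g (flip i u))%:Z))%R.
  rewrite /weight -antipode_flip !g_anti.
  have uv := adj_flip i u.
  have -> : adj_col c Red (antipode u) (antipode (flip i u)) =
            ~~ adj_col c Red u (flip i u).
    rewrite (adj_colE _ _ (adj_antipode uv)) (adj_colE _ _ uv).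
    by move: (anti _ _ uv); case: (c _); case: (c _).
  by case: adj_col; case: (g u); case: (g _).
by rewrite /weight; case: adj_col; case: (g u); case: (g _).
Qed.

Hypothesis g_component : forall u v,
  component c Red u = component c Red v ->
  component c Blue u = component c Blue v -> g u = g v.

(** A step inside a component of colour [k] which has the other colour stays in
    both components, hence has weight 0. *)
Lemma weight_component k i u :
    component c k u = component c k (flip i u) ->
  weight i u = ((-1) ^+ (k == Blue) * ((g (flip i u))%:Z - (g u)%:Z))%R.
Proof.
move=> kE; have := component_adj c (adj_flip i u); rewrite /weight.
case: adj_col; case: k kE => //= E E'; rewrite ?(g_component E E') //.
all: by rewrite ?(g_component E' E) subrr !mulr0.
Qed.

(** If one colour joins all four vertices, the weights on the square are, up to
    a common sign, differences of [g].  Otherwise the square is resolved because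
    it consists of a red and a blue path of length 2; these have the same ends,
    on which [g] then agrees. *)
Lemma weight_square i j u : i != j ->
    resolved c [set v : vertex n |
      [forall k, (k \notin [set i; j]) ==> (v k == u k)]] ->
  (weight i u + weight j (flip i u) = weight j u + weight i (flip j u))%R.
Proof.
move=> ij /(resolved_diagonal ij)[k diag].
have joined l : component c l u = component c l (flip i u) ->
    component c l u = component c l (flip j u) ->
    component c l u = component c l (flip i (flip j u)) ->
    (weight i u + weight j (flip i u) = weight j u + weight i (flip j u))%R.
  move=> Eb Ed Ee.
  rewrite !(weight_component (k := l)) -?Eb -?Ed -?(flipC i j) //.
  by case: (l == Blue); rewrite /= ?expr0 ?expr1; lia.
move: diag (component_adj c (adj_flip i u)) (component_adj c (adj_flip j u))
  (component_adj c (adj_flip j (flip i u)))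
  (component_adj c (adj_flip i (flip j u))) joined.
move: (@g_component u (flip i (flip j u))) (@g_component (flip i u) (flip j u)).
rewrite /weight (flipC j i).
set b := flip i u; set d := flip j u; set e := flip i d.
move: (component c) => comp g_ue g_bd diag.
case: (adj_col c Red u b) => Eub; case: (adj_col c Red u d) => Eud;
  case: (adj_col c Red b e) => Ebe; case: (adj_col c Red d e) => Ede joined.
(* three or four sides of the same colour *)
all: try by apply: (joined Red); congruence.
all: try by apply: (joined Blue); congruence.
(* two adjacent sides of each colour *)
all: try by rewrite g_ue; first [lia | congruence].
all: try by rewrite g_bd; first [lia | congruence].
(* alternating sides: the colour [k] of the joined diagonal joins all four *)
all: by apply: (joined k); case: k diag => -[] *; congruence.
Qed.

End Weight.

(** For a total order on the edges of [H], [g] marks the smaller edge in each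
    antipodal pair. *)
Lemma antipodal_labelling (n : nat) (c : colouring n) :
    antipodal c -> (forall v, ~~ connect (adj_col c Red) v (antipode v)) ->
  exists g : vertex n -> bool,
    (forall v, g (antipode v) = ~~ g v) /\
    (forall u v, component c Red u = component c Red v ->
       component c Blue u = component c Blue v -> g u = g v).
Proof.
move=> anti nc.
pose key v := enum_rank (component c Red v, component c Blue v).
have keyE u v : component c Red u = component c Red v ->
    component c Blue u = component c Blue v -> key u = key v.
  by rewrite /key => -> ->.
exists (fun v => key v < key (antipode v)); split=> [v|u v Ruv Buv].
  rewrite antipodeK -leqNgt ltn_neqAle.
  suff -> : (key (antipode v) != key v :> nat) by [].
  apply/eqP=> /val_inj/enum_rank_inj[/esym/eqP + _].
  by rewrite componentE (negPf (nc v)).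
by rewrite (keyE u v) // (keyE (antipode u) (antipode v)) //;
  [apply: (component_antipode anti Buv) | apply: (component_antipode anti Ruv)].
Qed.

Theorem theorem1p3 (n : nat) (hn : 3 <= n) (c : colouring n)
    (hanti : antipodal c)
    (hres : forall S : {set vertex n}, square_face S -> resolved c S) :
  exists v : vertex n, mono_connected c v (antipode v).
Proof.
case: (pickP (fun v => connect (adj_col c Red) v (antipode v))) => [v vP|nc].
  by exists v; apply: connect_mono vP.
have [g [g_anti g_comp]] := antipodal_labelling hanti (fun v => negbT (nc v)).
have [h hP] : exists h : vertex n -> int,
    forall i u, (h (flip i u) = h u + weight c g i u)%R.
  apply: closed_exact => [i u|i j u ij]; first exact: weight_flip.
  by apply: weight_square => //; apply: hres; exists i, j, u.
pose o : vertex n := [ffun=> false].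
have h_antipode : h (antipode o) = h o.
  have shift v : (h (antipode v) - h v = h (antipode o) - h o)%R.
    move: v; apply: (flip_ind (u := o)) => // i v <-.
    by rewrite antipode_flip !hP (weight_antipode _ _ hanti g_anti); lia.
  by have := shift (antipode o); rewrite antipodeK; lia.
have h_parity v : exists m : int,
    (h v - h o = (g v)%:Z - (g o)%:Z + 2 * m)%R.
  move: v; apply: (flip_ind (u := o)) => [|i v [m mP]].
    by exists 0%R; lia.
  rewrite hP /weight; case: adj_col; rewrite /= ?expr0 ?expr1.
    by exists m; lia.
  by exists (m + (g v)%:Z - (g (flip i v))%:Z)%R; lia.
have [m] := h_parity (antipode o).
by rewrite h_antipode g_anti; case: (g o); lia.
Qed.
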